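(* Assume: (i) $\boldsymbol\xi=\mathbf P\mathbf R^T\boldsymbol\xi+\mathbf P_\perp\mathbf R_\perp^T\boldsymbol\xi$ for all $\boldsymbol\xi\in\mathbb R^N$; (ii) there are constants $M_{\mathbf P},M_{\mathbf P_\perp}\in\mathbb R$ with $\|\mathbf P\boldsymbol\eta\|\le M_{\mathbf P}\|\boldsymbol\eta\|$ for all $\boldsymbol\eta\in\mathbb R^{\bar N}$ and $\|\mathbf P_\perp\boldsymbol\eta\|\le M_{\mathbf P_\perp}\|\boldsymbol\eta\|$ for all $\boldsymbol\eta\in\mathbb R^{N-\bar N}$; (iii) the fine propagator is stable: there is a constant $C_{\mathcal F}\ge0$ with $\|\mathcal F(\boldsymbol\xi;t^i,t^j)\|\le(1+C_{\mathcal F}(t^j-t^i))\|\boldsymbol\xi\|$ for all $\boldsymbol\xi\in\mathbb R^N$ and $0\le i\le j\le m$; (iv) there are constants $M_\perp,M_{\mathbf r_j}\in\mathbb R$ with $\|\mathbf P_\perp\mathbf R_\perp^T\boldsymbol\xi\|\le M_\perp\|\boldsymbol\xi\|$ and $\|\mathbf r_j^T\boldsymbol\xi\|\le M_{\mathbf r_j}\|\boldsymbol\xi\|$ for all $\boldsymbol\xi\in\mathbb R^N$, $j=1,\dots,\bar N$. Then employing the local-forecast coarse propagator $\mathcal G=\mathcal G_{\mathrm{LF}}$ in the parareal recurrence yields a stable recurrence, as the iterates satisfy $$\|\mathbf x_k^n\|\le(\alpha_A)^n\exp(C_A nH)\|\mathbf x^0\|+\sum_{j=1}^n(\alpha_A)^{n-j}\alpha_B\exp\big(((n-j)C_A+C_B)H\big)\|\mathbf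 x_{k-1}^{j-1}\|,\qquad 1\le k\le n\le M,$$ $$\|\mathbf x_n^n\|\le\sum_{j=0}^n\binom nj(\alpha_A)^j(\alpha_B)^{n-j}\exp\big((jC_A+(n-j)C_B)H\big)\|\mathbf x^0\|,\qquad 1\le n\le M,$$ with $$\alpha_A=\sqrt{\bar N}M_{\mathbf P}\max_{1\le j\le\bar N,\,0\le n\le M-1}M_{\mathbf r_j}\alpha_j^n,\qquad C_A=C_{\mathcal F}\max_{1\le j\le\bar N,\,0\le n\le M-1}C_j^n,$$ $$\alpha_B=M_\perp+\sqrt{\bar N}M_{\mathbf P}\max_{1\le j\le\bar N,\,0\le n\le M-1}M_{\mathbf r_j}(\alpha_j^n+1),\qquad C_B=C_{\mathcal F}.$$
   Context: Norms are Euclidean. Let $N,M,\bar m$ be positive integers, $m=\bar m M$, $T_{\mathrm{final}}>0$, $h=T_{\mathrm{final}}/m$, $H=T_{\mathrm{final}}/M=\bar m h$; fine time instances $t^i=ih$ ($0\le i\le m$), coarse time instances $T^n=nH=t^{\bar m n}$ ($0\le n\le M$). The fine propagator $\mathcal F(\boldsymbol\xi;t^i,t^j)\in\mathbb R^N$ propagates a state $\boldsymbol\xi\in\mathbb R^N$ from $t^i$ to $t^j$ ($i\le j$), with $\mathcal F(\cdot;t^i,t^k)=\mathcal F(\cdot;t^j,t^k)\circ\mathcal F(\cdot;t^i,t^j)$ for $i\le j\le k$. Let $1\le\bar N\le N$, $\mathbf R=[\mathbf r_1\ \cdots\ \mathbf r_{\bar N}]\in\mathbb R^{N\times\bar N}$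 (restriction operator $\mathbf R^T$), $\mathbf P\in\mathbb R^{N\times\bar N}$ (prolongation operator), with counterparts $\mathbf R_\perp,\mathbf P_\perp\in\mathbb R^{N\times(N-\bar N)}$. The memory $\alpha$ and basis dimension $a$ are positive integers with $a\le\alpha\le\bar m$. For $1\le j\le\bar N$, $0\le n\le M-1$, the local time-evolution basis $\boldsymbol\Xi_j^n\in\mathbb R^{\bar m\times a}$ has orthonormal columns. $\mathbf Z_0\in\{0,1\}^{\alpha\times\bar m}$ extracts the first $\alpha$ entries of a vector in $\mathbb R^{\bar m}$. With $^+$ the Moore--Penrose pseudoinverse and $\mathbf e_i$ canonical unit vectors, $\gamma_{ij}^n:=\mathbf e_{\bar m}^T\boldsymbol\Xi_j^n[\mathbf Z_0\boldsymbol\Xi_j^n]^+\mathbf e_i$ ($1\le i\le\alpha$) and $\boldsymbol\Gamma_i^n:=\mathrm{diag}(\gamma_{i1}^n,\dots,\gamma_{i\bar N}^n)$. The local-forecast coarse propagator is $$\mathcal G_{\mathrm{LF}}(\boldsymbol\xi;T^n,T^{n+1})=\mathbf P\mathbf R^T\boldsymbol\xi+\mathbf P\sum_{i=1}^{\alpha}\boldsymbol\Gamma_i^n\left[\mathbf R^T\mathcal F(\boldsymbol\xi;T^n,t^{\bar m n+i})-\mathbf R^T\boldsymbol\xi\right].$$ Further, $$\lambda_j^n:=\Big|1-\sum_{i=1}^\alpha\gamma_{ij}^n\Big|,\quad\kappa_j^n:=\sqrt{\sum_{i=1}^\alpha(\gamma_{ij}^n)^2},\quad\alpha_j^n:=\lambda_j^n+\kappa_j^n\sqrt\alpha,\quad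 C_j^n:=\frac{(\alpha/\bar m)\kappa_j^n\sqrt\alpha}{\lambda_j^n+\kappa_j^n\sqrt\alpha}.$$ Parareal recurrence with coarse propagator $\mathcal G$: given the initial state $\mathbf x^0\in\mathbb R^N$ and an initial guess $\mathbf x_0^0=\mathbf x^0,\mathbf x_0^1,\dots,\mathbf x_0^M$, the iterates satisfy, for $k=0,\dots,M-1$, $$\mathbf x_{k+1}^{n+1}=\mathcal G(\mathbf x_{k+1}^n;T^n,T^{n+1})+\mathcal F(\mathbf x_k^n;T^n,T^{n+1})-\mathcal G(\mathbf x_k^n;T^n,T^{n+1}),\qquad n=k,\dots,M-1,$$ and $\mathbf x_{k+1}^n=\mathbf x_k^n$ for $n\le k$ (so in particular $\mathbf x_k^0=\mathbf x^0$ for all $k$). *)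

(* Defs.v *)
From HB Require Import structures.
From mathcomp Require Import all_boot all_order all_algebra.
From mathcomp Require Import all_classical all_reals all_analysis.

Set Implicit Arguments.
Unset Strict Implicit.
Unset Printing Implicit Defensive.

Import Order.TTheory GRing.Theory Num.Theory.

Local Open Scope ring_scope.

Section LinearAlgebra.
Variable K : realType.

(* The library norm on matrices is the sup norm, hence this definition. *)
Definition enorm d (v : 'cV[K]_d) : K := Num.sqrt (\sum_i v i 0 ^+ 2).

(* k-th canonical unit vector of R^d, counted from 1. *)
Definition unit_vec d (k : nat) : 'cV[K]_d := \col_(i < d) (i.+1 == k)%:R.

(* The four Penrose conditions. *)
Definition is_mp_inverse p q (A : 'M[K]_(p, q)) (B : 'M[K]_(q, p)) : Prop :=
  [/\ A *m B *m A = A, B *m A *m B = B,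
      (A *m B)^T = A *m B & (B *m A)^T = B *m A].

Definition mp_inverse p q (A : 'M[K]_(p, q)) : 'M[K]_(q, p) :=
  xget 0 [set B | is_mp_inverse A B]%classic.

Lemma row_free_gram_unit p q (A : 'M[K]_(p, q)) :
  row_free A -> A *m A^T \in unitmx.
Proof.
move=> fA; rewrite -row_free_unit; apply/inj_row_free => v v0.
have vA0 : v *m A = 0.
  have : ((v *m A) *m (v *m A)^T) 0 0 = 0.
    by rewrite trmx_mul mulmxA -(mulmxA v A) v0 mul0mx mxE.
  rewrite mxE => s0; have ge0 k : 0 <= (v *m A) 0 k * (v *m A)^T k 0.
    by rewrite [X in _ * X]mxE -expr2 sqr_ge0.
  apply/matrixP => i j; rewrite ord1 [RHS]mxE.
  have /eqP : (v *m A) 0 j * (v *m A)^T j 0 = 0.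
    by apply: (psumr_eq0P _ s0) => // k _; exact: ge0.
  by rewrite [X in _ * X]mxE -expr2 sqrf_eq0 => /eqP.
by apply: (row_free_inj fA); rewrite vA0 mul0mx.
Qed.

Lemma mp_inverse_uniq p q (A : 'M[K]_(p, q)) B C :
  is_mp_inverse A B -> is_mp_inverse A C -> B = C.
Proof.
move=> [b1 b2 b3 b4] [c1 c2 c3 c4].
have AB : A *m B = A *m C.
  rewrite -[LHS]b3 -{1}c1 -(mulmxA _ A B) trmx_mul b3 c3.
  by rewrite mulmxA b1.
have BA : B *m A = C *m A.
  rewrite -[LHS]b4 -{1}c1 -(mulmxA A C A) mulmxA trmx_mul b4 c4.
  by rewrite -!mulmxA (mulmxA A) b1.
by rewrite -b2 BA -mulmxA AB mulmxA c2.
Qed.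

Lemma mp_inverseP p q (A : 'M[K]_(p, q)) : is_mp_inverse A (mp_inverse A).
Proof.
apply: (@xgetPex _ 0 [set B | is_mp_inverse A B]%classic).
have [r [C [D [AE fD fC]]]] : exists r (C : 'M[K]_(p, r)) (D : 'M[K]_(r, q)),
    [/\ A = C *m D, row_free D & row_full C].
  exists (\rank A), (col_base A), (row_base A).
  by rewrite mulmx_base row_base_free col_base_full.
have uD : D *m D^T \in unitmx by exact: row_free_gram_unit.
have uC : C^T *m C \in unitmx.
  rewrite -{2}(trmxK C); apply: row_free_gram_unit.
  by rewrite /row_free mxrank_tr; exact: fC.
pose iC := invmx (C^T *m C); pose iD := invmx (D *m D^T).
have iCT : iC^T = iC by rewrite /iC trmx_inv trmx_mul trmxK.
have iDT : iD^T = iD by rewrite /iD trmx_inv trmx_mul trmxK.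
pose B := D^T *m iD *m iC *m C^T.
have AB : A *m B = C *m iC *m C^T.
  by rewrite AE /B !mulmxA -(mulmxA C D) -(mulmxA C _ iD) mulmxV // mulmx1.
have BA : B *m A = D^T *m iD *m D.
  by rewrite AE /B !mulmxA -(mulmxA _ C^T C) -(mulmxA _ iC) mulVmx // mulmx1.
exists B; split.
- by rewrite AB {1}AE mulmxA -(mulmxA _ C^T C) -(mulmxA C) mulVmx // mulmx1 -AE.
- by rewrite BA /B !mulmxA -(mulmxA _ D) -(mulmxA _ _ iD) mulmxV // mulmx1.
- by rewrite AB !trmx_mul trmxK iCT mulmxA.
- by rewrite BA !trmx_mul trmxK iDT mulmxA.
Qed.

End LinearAlgebra.

Section Parareal.
Variable K : realType.

Definition fine_time (Tfinal : K) (m i : nat) : K := i%:R * (Tfinal / m%:R).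

(* F i j xi stands for F(xi; t^i, t^j); G n xi stands for G(xi; T^n, T^{n+1});
   x k n is the iterate x_k^n.  T^n is the fine instance of index mbar * n. *)
Definition parareal (N M mbar : nat) (F : nat -> nat -> 'cV[K]_N -> 'cV[K]_N)
    (G : nat -> 'cV[K]_N -> 'cV[K]_N) (x0 : 'cV[K]_N)
    (x : nat -> nat -> 'cV[K]_N) : Prop :=
  [/\ x 0%N 0%N = x0,
      forall k n : nat, (k <= n)%N -> (n < M)%N ->
        x k.+1 n.+1 = G n (x k.+1 n)
          + F (mbar * n)%N (mbar * n.+1)%N (x k n) - G n (x k n)
    & forall k n : nat, (k < M)%N -> (n <= k)%N -> x k.+1 n = x k n].

Definition extract_first (alpha mbar : nat) : 'M[K]_(alpha, mbar) :=
  \matrix_(i < alpha, j < mbar) (i == j :> nat)%:R.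

(* In this block Xi is one local basis Xi_j^n, and i is counted from 1. *)
Section ForecastCoefficients.
Variables (alpha mbar a : nat) (Xi : 'M[K]_(mbar, a)).

Definition lf_gamma (i : nat) : K :=
  ((unit_vec K mbar mbar)^T *m Xi *m mp_inverse (extract_first alpha mbar *m Xi)
    *m unit_vec K alpha i) 0 0.

Definition lf_lambda : K := `|1 - \sum_(1 <= i < alpha.+1) lf_gamma i|.

Definition lf_kappa : K :=
  Num.sqrt (\sum_(1 <= i < alpha.+1) lf_gamma i ^+ 2).

Definition lf_alpha : K := lf_lambda + lf_kappa * Num.sqrt alpha%:R.

Definition lf_C : K :=
  (alpha%:R / mbar%:R) * lf_kappa * Num.sqrt alpha%:R
    / (lf_lambda + lf_kappa * Num.sqrt alpha%:R).

End ForecastCoefficients.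

Definition lf_Gamma (alpha mbar a Nbar : nat)
    (Xin : 'I_Nbar -> 'M[K]_(mbar, a)) (i : nat) : 'M[K]_Nbar :=
  diag_mx (\row_(j < Nbar) lf_gamma alpha (Xin j) i).

Definition local_forecast (N Nbar mbar alpha a : nat) (R P : 'M[K]_(N, Nbar))
    (F : nat -> nat -> 'cV[K]_N -> 'cV[K]_N)
    (Xi : nat -> 'I_Nbar -> 'M[K]_(mbar, a)) (n : nat) (xi : 'cV[K]_N) :
    'cV[K]_N :=
  P *m (R^T *m xi)
  + P *m \sum_(1 <= i < alpha.+1)
      lf_Gamma alpha (Xi n) i
        *m (R^T *m F (mbar * n)%N (mbar * n + i)%N xi - R^T *m xi).

(* Maximum over 1 <= j <= Nbar and 0 <= n <= M - 1.  The unit 0 of the iterated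
   max is harmless for nonnegative entries; those used below are nonnegative,
   as lf_alpha and lf_C are and any constant bounding |r_j^T xi| / |xi| is. *)
Definition max_jn (Nbar M : nat) (f : 'I_Nbar -> nat -> K) : K :=
  \big[Num.max/0]_(j < Nbar) \big[Num.max/0]_(n < M) f j n.

End Parareal.

(* Main.v *)
(** Both [G] and [F - G] are linearly bounded: in reduced coordinates the
    forecast is [(1 - sum_i gamma_i) r^T xi + sum_i gamma_i r^T F_i xi], so
    Cauchy-Schwarz on the memory sum and stability of [F] over at most
    [alpha h = (alpha / mbar) H] give [|G xi| <= A |xi|] with
    [A = alphaA exp(CA H)], and splitting [F xi] along [P] and [Pperp] gives
    [|F xi - G xi| <= B |xi|] with [B = alphaB exp(CB H)].  Hence
    [|x_{k+1}^{n+1}| <= A |x_{k+1}^n| + B |x_k^n|]; unrolling in [n] yields the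
    first bound, and on the diagonal, where [x_{n+1}^n = x_n^n], one gets
    [|x_n^n| <= (A + B)^n |x^0|], which the binomial theorem expands. *)

Require Import Defs.
From HB Require Import structures.
From mathcomp Require Import all_boot all_order all_algebra.
From mathcomp Require Import all_classical all_reals all_analysis.
From mathcomp Require Import ring lra.

Set Implicit Arguments.
Unset Strict Implicit.
Unset Printing Implicit Defensive.

Import Order.TTheory GRing.Theory Num.Theory.

Local Open Scope ring_scope.

(** * Cauchy-Schwarz and the Euclidean norm *)

(** Lagrange's identity: the sum over all i, j of (f_i g_j - f_j g_i)^2 is nonnegative and equals
    twice the gap between the squared sides. *)
Lemma CauchySchwarz_sum (K : rcfType) (I : Type) (r : seq I) (f g : I -> K) :
  `|\sum_(i <- r) f i * g i|
    <= Num.sqrt (\sum_(i <- r) f i ^+ 2) * Num.sqrt (\sum_(i <- r) g i ^+ 2).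
Proof.
have s0 (h : I -> K) : 0 <= \sum_(i <- r) h i ^+ 2.
  by apply: sumr_ge0 => i _; exact: sqr_ge0.
rewrite -sqrtrM // -sqrtr_sqr ler_wsqrtr //.
have : 0 <= \sum_(i <- r) \sum_(j <- r) (f i * g j - f j * g i) ^+ 2.
  by apply: sumr_ge0 => i _; apply: sumr_ge0 => j _; exact: sqr_ge0.
suff -> : \sum_(i <- r) \sum_(j <- r) (f i * g j - f j * g i) ^+ 2
    = 2 * ((\sum_(i <- r) f i ^+ 2) * \sum_(i <- r) g i ^+ 2
           - (\sum_(i <- r) f i * g i) ^+ 2).
  by rewrite pmulr_rge0 // subr_ge0.
set F2 := \sum_(i <- r) f i ^+ 2; set G2 := \sum_(i <- r) g i ^+ 2.
set S := \sum_(i <- r) f i * g i.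
(* Writing one product as [G2 * F2] makes the distributed double sums match term by term, without
   exchanging i and j. *)
have -> : 2 * (F2 * G2 - S ^+ 2) = F2 * G2 + (G2 * F2 - 2 * (S * S)) by ring.
rewrite /F2 /G2 /S !big_distrlr /= mulr_sumr -sumrB -big_split /=.
apply: eq_bigr => i _; rewrite mulr_sumr -sumrB -big_split /=.
by apply: eq_bigr => j _; ring.
Qed.

Section EuclideanNorm.
Variables (K : realType) (d : nat).
Implicit Types u v : 'cV[K]_d.

Lemma enorm_ge0 v : 0 <= enorm v.
Proof. exact: sqrtr_ge0. Qed.

Lemma ler_enormD u v : enorm (u + v) <= enorm u + enorm v.
Proof.
rewrite -(ger0_norm (addr_ge0 (enorm_ge0 u) (enorm_ge0 v))) -sqrtr_sqr.
apply: ler_wsqrtr.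
have s0 (w : 'cV[K]_d) : 0 <= \sum_i w i 0 ^+ 2.
  by apply: sumr_ge0 => i _; exact: sqr_ge0.
rewrite sqrrD !sqr_sqrtr //.
have -> : \sum_i (u + v) i 0 ^+ 2
    = \sum_i u i 0 ^+ 2 + (\sum_i u i 0 * v i 0) *+ 2 + \sum_i v i 0 ^+ 2.
  by rewrite -sumrMnl -!big_split; apply: eq_bigr => i _; rewrite mxE sqrrD.
rewrite lerD2r lerD2l lerMn2r /=.
exact: le_trans (ler_norm _) (CauchySchwarz_sum _ _ _).
Qed.

(** This passage from coordinates to the norm is the source of the factor sqrt(Nbar) in [alphaA] and
    [alphaB]. *)
Lemma enorm_le_const v c :
  0 <= c -> (forall i, `|v i 0| <= c) -> enorm v <= Num.sqrt d%:R * c.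
Proof.
move=> c0 vc; rewrite -(ger0_norm c0) -sqrtr_sqr -sqrtrM ?ler0n //.
apply: ler_wsqrtr; rewrite mulr_natl.
have <- : \sum_(i < d) c ^+ 2 = c ^+ 2 *+ d by rewrite sumr_const card_ord.
by apply: ler_sum => i _; rewrite -real_normK ?num_real // lerXn2r ?nnegrE.
Qed.

Lemma enorm_const1 : enorm (const_mx 1 : 'cV[K]_d) = Num.sqrt d%:R.
Proof.
congr Num.sqrt; rewrite (eq_bigr (fun=> 1)) ?sumr_const ?card_ord //.
by move=> i _; rewrite mxE expr1n.
Qed.

(** The bounding constants are given as arbitrary reals; testing on the all-ones vector, of norm
    sqrt(d) > 0, fixes their sign. *)
Lemma bound_ge0 (f : 'cV[K]_d -> K) c :
  (0 < d)%N -> (forall v, 0 <= f v) -> (forall v, f v <= c * enorm v) -> 0 <= c.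
Proof.
move=> d0 f0 /(_ (const_mx 1)) /(le_trans (f0 _)).
by rewrite enorm_const1 pmulr_lge0 // sqrtr_gt0 ltr0n.
Qed.

End EuclideanNorm.

Lemma enorm_col_mul (K : realType) N Nbar (R : 'M[K]_(N, Nbar)) j v :
  enorm ((col j R)^T *m v) = `|(R^T *m v) j 0|.
Proof. by rewrite /enorm big_ord1 sqrtr_sqr tr_col -row_mul mxE. Qed.

Lemma le_max_jn (K : realType) Nbar M (f : 'I_Nbar -> nat -> K) j n :
  (n < M)%N -> f j n <= max_jn M f.
Proof.
move=> nM; apply: le_trans (le_bigmax _ _ j).
exact: (le_bigmax _ (fun n : 'I_M => f j n) (Ordinal nM)).
Qed.

Lemma max_jn_ge0 (K : realType) Nbar M (f : 'I_Nbar -> nat -> K) :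
  0 <= max_jn M f.
Proof. exact: bigmax_ge_id. Qed.

(** Regroup as (1 - sum g_i) y0 + sum g_i y_i. Only the second term sees the growth 1 + e, and
    Cauchy-Schwarz against a constant yields the sqrt(alpha). *)
Lemma forecast_le (K : rcfType) (alpha : nat) (g y : nat -> K) (y0 Y e : K) :
  0 <= Y -> 0 <= e -> `|y0| <= Y ->
  (forall i, (1 <= i < alpha.+1)%N -> `|y i| <= (1 + e) * Y) ->
  `|y0 + \sum_(1 <= i < alpha.+1) g i * (y i - y0)|
    <= (`|1 - \sum_(1 <= i < alpha.+1) g i|
        + Num.sqrt (\sum_(1 <= i < alpha.+1) g i ^+ 2) * Num.sqrt alpha%:R
          * (1 + e)) * Y.
Proof.
move=> Y0 e0 y0Y yY.
have -> : y0 + \sum_(1 <= i < alpha.+1) g i * (y i - y0)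
    = (1 - \sum_(1 <= i < alpha.+1) g i) * y0
      + \sum_(1 <= i < alpha.+1) g i * y i.
  rewrite (eq_bigr (fun i => g i * y i - g i * y0)) => [|i _]; last by ring.
  by rewrite sumrB -mulr_suml; ring.
apply: le_trans (ler_normD _ _) _; rewrite [X in _ <= X]mulrDl lerD //.
  by rewrite normrM ler_wpM2l.
apply: le_trans (CauchySchwarz_sum _ _ _) _.
rewrite -!mulrA ler_wpM2l ?sqrtr_ge0 //.
have eY : 0 <= (1 + e) * Y by rewrite mulr_ge0 // addr_ge0.
rewrite -(ger0_norm eY) -sqrtr_sqr -sqrtrM ?ler0n //.
apply: ler_wsqrtr; rewrite mulr_natl.
have <- : \sum_(1 <= i < alpha.+1) ((1 + e) * Y) ^+ 2
    = ((1 + e) * Y) ^+ 2 *+ alpha by rewrite sumr_const_nat subn1.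
apply: ler_sum_nat => i /yY yi.
by rewrite -real_normK ?num_real // lerXn2r ?nnegrE.
Qed.

(** * Relations between the forecast constants *)

Section ForecastConstants.
Variables (K : realType) (alpha mbar a : nat) (X : 'M[K]_(mbar, a)).

Lemma lf_alpha_ge0 : 0 <= lf_alpha alpha X.
Proof. by rewrite addr_ge0 ?normr_ge0 ?mulr_ge0 ?sqrtr_ge0. Qed.

(* The division in [lf_C] gives 0 when [lf_alpha] vanishes, and then so does
   the right-hand side. *)
Lemma lf_alpha_mulC :
  lf_alpha alpha X * lf_C alpha X
  = (alpha%:R / mbar%:R) * lf_kappa alpha X * Num.sqrt alpha%:R.
Proof.
rewrite /lf_C -/(lf_alpha alpha X).
have [a0|an0] := eqVneq (lf_alpha alpha X) 0; last by rewrite mulrC divfK.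
have : lf_kappa alpha X * Num.sqrt alpha%:R = 0.
  have l0 : 0 <= lf_lambda alpha X by exact: normr_ge0.
  have k0 : 0 <= lf_kappa alpha X * Num.sqrt alpha%:R.
    by rewrite mulr_ge0 ?sqrtr_ge0.
  by move: a0; rewrite /lf_alpha; lra.
by move=> ks0; rewrite a0 mul0r -mulrA ks0 mulr0.
Qed.

(** [lf_alpha * lf_C] is alpha/mbar <= 1 times a summand of [lf_alpha]. This is what allows [CB] to
    be C_F itself. *)
Lemma lf_C_le1 : (alpha <= mbar)%N -> (0 < mbar)%N -> lf_C alpha X <= 1.
Proof.
move=> am m0; have [a0|an0] := eqVneq (lf_alpha alpha X) 0.
  by rewrite /lf_C -/(lf_alpha alpha X) a0 invr0 mulr0.
have ap : 0 < lf_alpha alpha X by rewrite lt0r an0 lf_alpha_ge0.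
rewrite -(ler_pM2l ap) lf_alpha_mulC mulr1 -mulrA.
have k0 : 0 <= lf_kappa alpha X * Num.sqrt alpha%:R.
  by rewrite mulr_ge0 ?sqrtr_ge0.
apply: (@le_trans _ _ (lf_kappa alpha X * Num.sqrt alpha%:R)).
  by rewrite ler_piMl // ler_pdivrMr ?ltr0n // mul1r ler_nat.
by rewrite /lf_alpha lerDr normr_ge0.
Qed.

End ForecastConstants.

(** Discrete variation of constants, with [z], the previous parareal iterate, as forcing term. *)
Lemma linear_recurrence_le (K : numDomainType) (A B : K) (y z : nat -> K) M :
  0 <= A -> (forall n, (n < M)%N -> y n.+1 <= A * y n + B * z n) ->
  forall n, (n <= M)%N ->
  y n <= A ^+ n * y 0%N + \sum_(1 <= j < n.+1) A ^+ (n - j) * B * z j.-1.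
Proof.
move=> A0 step; elim=> [_|n IH nM]; first by rewrite big_geq // mul1r addr0.
apply: le_trans (step n nM) _.
rewrite big_nat_recr //= subnn expr0 mul1r addrA lerD2r.
apply: le_trans (ler_wpM2l A0 (IH (ltnW nM))) _.
rewrite mulrDr mulrA -exprS lerD2l mulr_sumr le_eqVlt; apply/orP; left.
apply/eqP; apply: eq_big_nat => j /andP[_ jn].
by rewrite subSn // exprS !mulrA.
Qed.

(** * Linear bounds on G and on F - G *)

Section Propagators.
Variables (K : realType) (N Nbar mbar alpha a : nat) (R P : 'M[K]_(N, Nbar)).
Variables (F : nat -> nat -> 'cV[K]_N -> 'cV[K]_N).
Variable (Xi : nat -> 'I_Nbar -> 'M[K]_(mbar, a)).

(** The argument of P in G: since the Gamma_i are diagonal, each coordinate is a scalar forecast as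
    in [forecast_le]. *)
Definition reduced_forecast n (xi : 'cV[K]_N) : 'cV[K]_Nbar :=
  \col_j ((R^T *m xi) j 0 + \sum_(1 <= i < alpha.+1) lf_gamma alpha (Xi n j) i
    * ((R^T *m F (mbar * n)%N (mbar * n + i)%N xi) j 0 - (R^T *m xi) j 0)).

Lemma local_forecastE n xi :
  local_forecast alpha R P F Xi n xi = P *m reduced_forecast n xi.
Proof.
rewrite /local_forecast -mulmxDr; congr (P *m _).
apply/colP => j; rewrite !mxE summxE; congr (_ + _).
by apply: eq_bigr => i _; rewrite mul_diag_mx !mxE.
Qed.

Variables (M : nat) (H MP CF : K) (Mr : 'I_Nbar -> K).
Hypothesis mbar_gt0 : (0 < mbar)%N.
Hypothesis alpha_le : (alpha <= mbar)%N.
Hypothesis H_ge0 : 0 <= H.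
Hypothesis CF_ge0 : 0 <= CF.
Hypothesis MP_ge0 : 0 <= MP.
Hypothesis Mr_ge0 : forall j, 0 <= Mr j.
Hypothesis P_le : forall eta, enorm (P *m eta) <= MP * enorm eta.
Hypothesis R_le : forall j xi, `|(R^T *m xi) j 0| <= Mr j * enorm xi.
Hypothesis F_stable : forall n i xi, (n < M)%N -> (i <= mbar)%N ->
  enorm (F (mbar * n)%N (mbar * n + i)%N xi)
    <= (1 + CF * (i%:R / mbar%:R * H)) * enorm xi.

Lemma reduced_forecast_le n j xi : (n < M)%N ->
  `|reduced_forecast n xi j 0|
    <= Mr j * lf_alpha alpha (Xi n j)
       * (1 + CF * lf_C alpha (Xi n j) * H) * enorm xi.
Proof.
move=> nM; rewrite mxE.
(* C_F alpha h, the growth of F over the whole memory window, which covers every i <= alpha. *)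
pose e := CF * (alpha%:R / mbar%:R * H).
have e0 : 0 <= e by rewrite !mulr_ge0.
have Mrx : 0 <= Mr j * enorm xi by rewrite mulr_ge0 ?enorm_ge0.
apply: le_trans (@forecast_le _ alpha _ (fun i =>
  (R^T *m F (mbar * n)%N (mbar * n + i)%N xi) j 0) _ _ e Mrx e0 _ _) _ => //.
  move=> i /andP[_]; rewrite ltnS => ia; apply: le_trans (R_le _ _) _.
  rewrite [leRHS]mulrCA ler_wpM2l //.
  apply: le_trans (F_stable _ nM (leq_trans ia alpha_le)) _.
  rewrite ler_wpM2r ?enorm_ge0 // lerD2l ler_wpM2l // ler_wpM2r //.
  by rewrite ler_wpM2r ?invr_ge0 // ler_nat.
rewrite -/(lf_lambda _ _) -/(lf_kappa _ _) le_eqVlt; apply/orP; left; apply/eqP.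
(* C_j^n is designed so that lambda + kappa sqrt(alpha) (1 + e) = L (1 + C_F C H); using the product
   [L * C] avoids dividing by L. *)
have := lf_alpha_mulC alpha (Xi n j); set L := lf_alpha _ _; set C := lf_C _ _.
move=> LC; transitivity ((L + CF * (L * C) * H) * (Mr j * enorm xi)).
  by rewrite LC /L /lf_alpha /e; congr (_ * _); ring.
by ring.
Qed.

Let alphaA := Num.sqrt Nbar%:R * MP
  * max_jn M (fun j n => Mr j * lf_alpha alpha (Xi n j)).
Let CA := CF * max_jn M (fun j n => lf_C alpha (Xi n j)).

Lemma local_forecast_le n xi : (n < M)%N ->
  enorm (local_forecast alpha R P F Xi n xi)
    <= alphaA * expR (CA * H) * enorm xi.
Proof.
move=> nM; rewrite local_forecastE; apply: le_trans (P_le _) _.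
pose m := max_jn M (fun j n => Mr j * lf_alpha alpha (Xi n j)).
have m0 : 0 <= m by exact: max_jn_ge0.
have -> : alphaA * expR (CA * H) * enorm xi
    = MP * (Num.sqrt Nbar%:R * (m * expR (CA * H) * enorm xi)).
  by rewrite /alphaA -/m; ring.
rewrite ler_wpM2l // enorm_le_const ?mulr_ge0 ?expR_ge0 ?enorm_ge0 // => j.
apply: le_trans (reduced_forecast_le _ _ nM) _.
rewrite ler_wpM2r ?enorm_ge0 //.
have Lm : Mr j * lf_alpha alpha (Xi n j) <= m.
  exact: (le_max_jn (fun j n => Mr j * lf_alpha alpha (Xi n j))).
(* The two maxima are taken separately: first C_j^n is maximised and 1 + t <= exp(t) applied, then
   the prefactor is maximised. *)
apply: (@le_trans _ _ (Mr j * lf_alpha alpha (Xi n j) * expR (CA * H))).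
  rewrite ler_wpM2l ?mulr_ge0 ?lf_alpha_ge0 //.
  apply: le_trans (expR_ge1Dx _); rewrite lerD2l ler_wpM2r // ler_wpM2l //.
  exact: (le_max_jn (fun j n => lf_C alpha (Xi n j))).
by rewrite ler_wpM2r ?expR_ge0.
Qed.

Variables (Rperp Pperp : 'M[K]_(N, N - Nbar)) (Mperp : K).
Hypothesis decomp : forall xi : 'cV[K]_N,
  xi = P *m (R^T *m xi) + Pperp *m (Rperp^T *m xi).
Hypothesis Mperp_ge0 : 0 <= Mperp.
Hypothesis perp_le : forall xi : 'cV[K]_N,
  enorm (Pperp *m (Rperp^T *m xi)) <= Mperp * enorm xi.

Let alphaB := Mperp + Num.sqrt Nbar%:R * MP
  * max_jn M (fun j n => Mr j * (lf_alpha alpha (Xi n j) + 1)).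

Lemma local_forecast_error_le n xi : (n < M)%N ->
  enorm (F (mbar * n)%N (mbar * n.+1)%N xi
         - local_forecast alpha R P F Xi n xi)
    <= alphaB * expR (CF * H) * enorm xi.
Proof.
move=> nM; set E := expR (CF * H); set y := F _ _ xi.
have yE : enorm y <= (1 + CF * H) * enorm xi.
  rewrite /y mulnS addnC; apply: le_trans (F_stable _ nM (leqnn _)) _.
  by rewrite divff ?mul1r // pnatr_eq0 -lt0n.
have EE : 1 + CF * H <= E by exact: expR_ge1Dx.
have E0 : 0 <= E by exact: expR_ge0.
have yEE : enorm y <= E * enorm xi.
  by apply: le_trans yE _; rewrite ler_wpM2r ?enorm_ge0.
(* Only F xi is split; its P-part merges with G into P applied to a difference of reduced
   vectors. *)
rewrite local_forecastE {1}(decomp y) addrAC -mulmxBr addrC.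
apply: le_trans (ler_enormD _ _) _.
rewrite /alphaB mulrDl mulrDl lerD //.
  by apply: le_trans (perp_le _) _; rewrite -mulrA ler_wpM2l.
apply: le_trans (P_le _) _.
pose m := max_jn M (fun j n => Mr j * (lf_alpha alpha (Xi n j) + 1)).
rewrite -/m; have m0 : 0 <= m by exact: max_jn_ge0.
have -> : Num.sqrt Nbar%:R * MP * m * E * enorm xi
    = MP * (Num.sqrt Nbar%:R * (m * (E * enorm xi))) by ring.
have Ex0 : 0 <= E * enorm xi by rewrite mulr_ge0 ?enorm_ge0.
rewrite ler_wpM2l // enorm_le_const ?mulr_ge0 ?enorm_ge0 // => j.
set L := lf_alpha alpha (Xi n j).
have Lm : Mr j * (L + 1) <= m.
  exact: (le_max_jn (fun j n => Mr j * (lf_alpha alpha (Xi n j) + 1))).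
apply: le_trans (ler_wpM2r Ex0 Lm).
(* The 1 pays for the restricted fine solution, L for the forecast. *)
have -> : Mr j * (L + 1) * (E * enorm xi)
    = Mr j * (E * enorm xi) + Mr j * L * (E * enorm xi) by ring.
have -> : (R^T *m y - reduced_forecast n xi) j 0
    = (R^T *m y) j 0 - reduced_forecast n xi j 0.
  by rewrite [LHS]mxE; congr (_ + _); rewrite [LHS]mxE.
apply: le_trans (ler_normB _ _) _; rewrite lerD //.
  by apply: le_trans (R_le _ _) _; rewrite ler_wpM2l.
apply: le_trans (reduced_forecast_le _ _ nM) _.
(* With C <= 1, the forecast growth 1 + C_F C H is also at most E. *)
rewrite -/L; have := lf_C_le1 (Xi n j) alpha_le mbar_gt0.
move: (lf_C _ _) => C C1; rewrite -!mulrA.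
rewrite ler_wpM2l // ler_wpM2l ?lf_alpha_ge0 // ler_wpM2r ?enorm_ge0 //.
apply: le_trans EE; rewrite lerD2l ler_wpM2l //.
by rewrite ler_piMl.
Qed.

Lemma local_forecast_constants_ge0 : 0 <= alphaA /\ 0 <= alphaB.
Proof. by split; rewrite ?addr_ge0 ?mulr_ge0 ?sqrtr_ge0 ?max_jn_ge0. Qed.

End Propagators.

(** * One-step and diagonal estimates for the iterates *)

Section PararealIterates.
Variables (K : realType) (N M mbar : nat).
Variables (F : nat -> nat -> 'cV[K]_N -> 'cV[K]_N).
Variables (G : nat -> 'cV[K]_N -> 'cV[K]_N) (x0 : 'cV[K]_N).
Variable x : nat -> nat -> 'cV[K]_N.
Hypothesis hx : parareal M mbar F G x0 x.

Lemma parareal_frozen k l n :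
  (n <= k)%N -> (k <= l)%N -> (l <= M)%N -> x l n = x k n.
Proof.
case: hx => _ _ fix_x nk; elim: l => [|l IH].
  by rewrite leqn0 => /eqP ->.
rewrite leq_eqVlt => /predU1P[->//|]; rewrite ltnS => kl lM.
by rewrite fix_x ?(leq_trans nk) // IH // ltnW.
Qed.

Variables A B : K.
Hypothesis G_le : forall n xi, (n < M)%N -> enorm (G n xi) <= A * enorm xi.
Hypothesis FG_le : forall n xi, (n < M)%N ->
  enorm (F (mbar * n)%N (mbar * n.+1)%N xi - G n xi) <= B * enorm xi.

(** G acts on the new iterate and F - G on the old one, so each bound applies separately. All n < M
    are covered, also those below the diagonal, because the unrolling in n starts at 0. *)
Lemma parareal_step_le k n : (k < M)%N -> (n < M)%N ->
  enorm (x k.+1 n.+1) <= A * enorm (x k.+1 n) + B * enorm (x k n).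
Proof.
move=> kM nM; have [_ step _] := hx.
have main l : (l <= n)%N ->
    enorm (x l.+1 n.+1) <= A * enorm (x l.+1 n) + B * enorm (x l n).
  move=> ln; rewrite step // -addrA.
  by apply: le_trans (ler_enormD _ _) _; rewrite lerD ?G_le ?FG_le.
have [kn|nk] := leqP k n; first exact: main.
(* For n < k the iterates no longer change, so the step k = n applies. *)
have nk1 : (n < k.+1)%N by exact: ltnW.
rewrite (parareal_frozen (leqnn _) nk1 kM) (parareal_frozen (leqnSn _) nk1 kM).
rewrite (parareal_frozen (leqnn _) (ltnW nk) (ltnW kM)).
exact: main.
Qed.

Lemma parareal_diag_le n : 0 <= A + B -> (n <= M)%N ->
  enorm (x n n) <= (A + B) ^+ n * enorm x0.
Proof.
move=> AB0; have [xE _ fix_x] := hx.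
elim: n => [_|n IH nM]; first by rewrite mul1r xE.
apply: le_trans (parareal_step_le nM nM) _.
by rewrite fix_x // -mulrDl exprS -mulrA ler_wpM2l // IH // ltnW.
Qed.

End PararealIterates.

(** * The two stability bounds *)

Theorem theorem4p11 (K : realType) (N M mbar Nbar alpha a : nat) (Tfinal : K)
    (F : nat -> nat -> 'cV[K]_N -> 'cV[K]_N)
    (R P : 'M[K]_(N, Nbar)) (Rperp Pperp : 'M[K]_(N, N - Nbar))
    (Xi : nat -> 'I_Nbar -> 'M[K]_(mbar, a))
    (x0 : 'cV[K]_N) (x : nat -> nat -> 'cV[K]_N)
    (MP MPperp CF Mperp : K) (Mr : 'I_Nbar -> K)
    (hN : (0 < N)%N) (hM : (0 < M)%N) (hmbar : (0 < mbar)%N)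
    (hNbar : (1 <= Nbar <= N)%N) (hT : 0 < Tfinal)
    (ha : (0 < a)%N) (haalpha : (a <= alpha)%N) (halpha : (alpha <= mbar)%N)
    (hF : forall (i j k : nat) (xi : 'cV[K]_N),
       (i <= j)%N -> (j <= k)%N -> (k <= mbar * M)%N ->
       F i k xi = F j k (F i j xi))
    (hXi : forall (n : nat) (j : 'I_Nbar), (n < M)%N ->
       (Xi n j)^T *m Xi n j = 1%:M)
    (h_decomp : forall xi : 'cV[K]_N,
       xi = P *m (R^T *m xi) + Pperp *m (Rperp^T *m xi))
    (hP : forall eta : 'cV[K]_Nbar, enorm (P *m eta) <= MP * enorm eta)
    (hPperp : forall eta : 'cV[K]_(N - Nbar),
       enorm (Pperp *m eta) <= MPperp * enorm eta)
    (hCF : 0 <= CF)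
    (hF_stable : forall (i j : nat) (xi : 'cV[K]_N),
       (i <= j)%N -> (j <= mbar * M)%N ->
       enorm (F i j xi)
         <= (1 + CF * (fine_time Tfinal (mbar * M) j
                        - fine_time Tfinal (mbar * M) i)) * enorm xi)
    (hMperp : forall xi : 'cV[K]_N,
       enorm (Pperp *m (Rperp^T *m xi)) <= Mperp * enorm xi)
    (hMr : forall (j : 'I_Nbar) (xi : 'cV[K]_N),
       enorm ((col j R)^T *m xi) <= Mr j * enorm xi)
    (hx : parareal M mbar F (local_forecast alpha R P F Xi) x0 x) :
  let H := Tfinal / M%:R in
  let alphaA := Num.sqrt Nbar%:R * MP
    * max_jn M (fun j n => Mr j * lf_alpha alpha (Xi n j)) in
  let CA := CF * max_jn M (fun j n => lf_C alpha (Xi n j)) in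
  let alphaB := Mperp + Num.sqrt Nbar%:R * MP
    * max_jn M (fun j n => Mr j * (lf_alpha alpha (Xi n j) + 1)) in
  let CB := CF in
  (forall k n : nat, (1 <= k)%N -> (k <= n)%N -> (n <= M)%N ->
     enorm (x k n)
       <= alphaA ^+ n * expR (CA * n%:R * H) * enorm x0
          + \sum_(1 <= j < n.+1)
              alphaA ^+ (n - j) * alphaB
                * expR (((n - j)%N%:R * CA + CB) * H)
                * enorm (x k.-1 j.-1))
  /\
  (forall n : nat, (1 <= n)%N -> (n <= M)%N ->
     enorm (x n n)
       <= (\sum_(0 <= j < n.+1)
             'C(n, j)%:R * alphaA ^+ j * alphaB ^+ (n - j)
               * expR ((j%:R * CA + (n - j)%N%:R * CB) * H)) * enorm x0).
Proof.
move=> H alphaA CA alphaB CB.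
have /andP[Nbar_gt0 _] := hNbar.
have R_le j v : `|(R^T *m v) j 0| <= Mr j * enorm v.
  by rewrite -enorm_col_mul; exact: hMr.
have MP_ge0 : 0 <= MP by exact: bound_ge0 (fun v => enorm_ge0 (P *m v)) hP.
have Mperp_ge0 : 0 <= Mperp.
  exact: bound_ge0 (fun v => enorm_ge0 (Pperp *m (Rperp^T *m v))) hMperp.
have Mr_ge0 j : 0 <= Mr j by exact: bound_ge0 (fun=> normr_ge0 _) (R_le j).
have H_ge0 : 0 <= H by rewrite divr_ge0 // ltW.
have F_stable n i v : (n < M)%N -> (i <= mbar)%N ->
    enorm (F (mbar * n)%N (mbar * n + i)%N v)
      <= (1 + CF * (i%:R / mbar%:R * H)) * enorm v.
  move=> nM im; have iM : (mbar * n + i <= mbar * M)%N.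
    by rewrite (leq_trans _ (leq_mul (leqnn mbar) nM)) // mulnS addnC leq_add2r.
  apply: le_trans (hF_stable _ _ v (leq_addr _ _) iM) _.
  rewrite le_eqVlt; apply/orP; left; apply/eqP; congr ((1 + CF * _) * _).
  (* The elapsed time is i h = (i / mbar) H. *)
  by rewrite /fine_time /H -mulrBl natrD !natrM invfM; ring.
have [alphaA_ge0 alphaB_ge0] : 0 <= alphaA /\ 0 <= alphaB.
  exact: local_forecast_constants_ge0.
pose A := alphaA * expR (CA * H); pose B := alphaB * expR (CB * H).
have A_ge0 : 0 <= A by rewrite mulr_ge0 ?expR_ge0.
have B_ge0 : 0 <= B by rewrite mulr_ge0 ?expR_ge0.
have G_le n v : (n < M)%N -> enorm (local_forecast alpha R P F Xi n v)
    <= A * enorm v by exact: local_forecast_le.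
have FG_le n v : (n < M)%N -> enorm (F (mbar * n)%N (mbar * n.+1)%N v
    - local_forecast alpha R P F Xi n v) <= B * enorm v.
  exact: local_forecast_error_le.
have AX i : A ^+ i = alphaA ^+ i * expR (CA * i%:R * H).
  by rewrite exprMn -expRM_natr; congr (_ * expR _); ring.
have BX i : B ^+ i = alphaB ^+ i * expR (CB * i%:R * H).
  by rewrite exprMn -expRM_natr; congr (_ * expR _); ring.
split=> [[//|k] n _ kn nM|n _ nM].
  have kM : (k < M)%N by exact: leq_trans nM.
  (* The unrolled recurrence starts from x_{k+1}^0, which never leaves the initial state. *)
  have -> : x0 = x k.+1 0%N.
    by rewrite (parareal_frozen hx (leqnn 0) (leq0n _) kM); case: hx.
  rewrite -AX.
  apply: le_trans (linear_recurrence_le (y := fun n => enorm (x k.+1 n))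
    (z := fun n => enorm (x k n)) A_ge0
    (fun n => parareal_step_le hx G_le FG_le kM) nM) _.
  rewrite lerD2l le_eqVlt; apply/orP; left; apply/eqP.
  apply: eq_bigr => j _; rewrite AX /B.
  have -> : ((n - j)%:R * CA + CB) * H = CA * (n - j)%:R * H + CB * H by ring.
  by rewrite expRD; ring.
apply: le_trans (parareal_diag_le hx G_le FG_le (addr_ge0 A_ge0 B_ge0) nM) _.
rewrite le_eqVlt; apply/orP; left; apply/eqP; congr (_ * _).
(* Commuting to B + A makes [exprDn] put the exponent j on A. *)
rewrite big_mkord addrC exprDn; apply: eq_bigr => j _; rewrite AX BX.
have -> : (j%:R * CA + (n - j)%:R * CB) * H
    = CA * j%:R * H + CB * (n - j)%:R * H by ring.
by rewrite expRD -mulr_natl; ring.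
Qed.
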